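(* Let $N_x,N_u,T$ be positive integers, $A\in\mathbb{R}^{N_x\times N_x}$, $B\in\mathbb{R}^{N_x\times N_u}$, and let an arbitrary set of support constraints be given. If there exists a closed-loop map $\phi$ satisfying the support constraints, the dynamics and the terminal condition $x(T)=0$, and if $$\operatorname{rank}(Z_h)=\operatorname{rank}(Z_hH),$$ then $\mathcal{S}(x_0)=\mathcal{T}(x_0)$ for (Lebesgue) almost every $x_0\in\mathbb{R}^{N_x}$.
   Context: A closed-loop map is a matrix $\phi=[\phi_x;\phi_u]\in\mathbb{R}^{(N_x+N_u)T\times N_x}$, with $\phi_x$ the stack of $\phi_x(0),\dots,\phi_x(T-1)\in\mathbb{R}^{N_x\times N_x}$ and $\phi_u$ the stack of $\phi_u(0),\dots,\phi_u(T-1)\in\mathbb{R}^{N_u\times N_x}$. It satisfies the dynamics and the terminal condition if $\phi_x(0)=I$, $\phi_x(t+1)=A\phi_x(t)+B\phi_u(t)$ for $0\le t\le T-2$, and $A\phi_x(T-1)+B\phi_u(T-1)=0$; equivalently $Z_{AB0}\phi=[I;0]$, where $Z_{AB0}$ is the matrix with $T+1$ block rows of height $N_x$ and $(N_x+N_u)T$ columns such that, on a stacked vector $(x(0),\dots,x(T-1),u(0),\dots,u(T-1))$, block row $0$ gives $x(0)$, block row $t$ ($1\le t\le T-1$) gives $x(t)-Ax(t-1)-Bu(t-1)$, and block row $T$ gives $-Ax(T-1)-Bu(T-1)$. Support constraints: a given set of entries of $\phi$ (i.e. of $\phi_x$ and $\phi_u$) is required to be zero. For $i\in\{1,\dots,N_x\}$,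 $R_i$ is the set of row indices $j$ such that $\phi[j,i]$ is constrained to be zero. $\mathcal{S}(x_0)$ is the set of all trajectories $\mathbf{s}=[\mathbf{x};\mathbf{u}]=(x(0),\dots,x(T-1),u(0),\dots,u(T-1))$ with $x(0)=x_0$, $x(t+1)=Ax(t)+Bu(t)$ for $0\le t\le T-1$, and $x(T)=0$ (no support constraints). $\mathcal{T}(x_0)$ is the set of trajectories $\mathbf{s}=\phi x_0$ where $\phi$ ranges over all closed-loop maps satisfying the dynamics, the terminal condition and the support constraints. With $\dagger$ the Moore–Penrose pseudoinverse: $Z_h=I-Z_{AB0}^\dagger Z_{AB0}$; $Z_h[R_i]$ is the submatrix of $Z_h$ formed by the rows indexed by $R_i$; $H_i=I-Z_h[R_i]^\dagger Z_h[R_i]$; and $H=[H_1,\dots,H_{N_x}]$. *)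

(* Defs.v *)
From HB Require Import structures.
From mathcomp Require Import all_boot all_order all_algebra.
From mathcomp Require Import all_classical all_reals all_analysis.

Set Implicit Arguments.
Unset Strict Implicit.
Unset Printing Implicit Defensive.

Import Order.TTheory GRing.Theory Num.Theory.
Import numFieldNormedType.Exports.

Local Open Scope classical_set_scope.
Local Open Scope ring_scope.

Section MoorePenrose.
Context {R : realType}.

Definition penrose m n (A : 'M[R]_(m, n)) (X : 'M[R]_(n, m)) : Prop :=
  [/\ A *m X *m A = A, X *m A *m X = X,
      (A *m X)^T = A *m X & (X *m A)^T = X *m A].

(* The default 0 is never taken: see penrose_mpinv. *)
Definition mpinv m n (A : 'M[R]_(m, n)) : 'M[R]_(n, m) :=
  xget 0 [set X | penrose A X].

Lemma penrose_uniq m n (A : 'M[R]_(m, n)) (X Y : 'M[R]_(n, m)) :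
  penrose A X -> penrose A Y -> X = Y.
Proof.
move=> [a1 a2 a3 a4] [b1 b2 b3 b4].
have AXY : A *m X = A *m Y.
  rewrite -a3 -b3 -{1}b1 -[A *m Y *m A *m X]mulmxA trmx_mul a3 b3.
  by rewrite mulmxA a1.
have XAY : X *m A = Y *m A.
  rewrite -[in RHS]a1 -[in RHS]mulmxA mulmxA -[in RHS]b4 -[in RHS]a4 -trmx_mul.
  by rewrite -mulmxA [A *m (_ *m _)]mulmxA b1 a4.
by rewrite -a2 XAY -mulmxA AXY mulmxA b2.
Qed.

Lemma row_free_gram r n (F : 'M[R]_(r, n)) :
  row_free F -> F *m F^T \in unitmx.
Proof.
move=> rF; rewrite -row_free_unit -kermx_eq0; apply/rowV0P => v.
move=> /sub_kermxP; rewrite mulmxA => vFF.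
have vF0 : v *m F = 0.
  have h : (v *m F) *m (v *m F)^T = 0.
    by rewrite trmx_mul mulmxA vFF mul0mx.
  apply/rowP => j; have /matrixP/(_ 0 0) := h; rewrite !mxE => /eqP.
  rewrite psumr_eq0 => [/allP /(_ j)|i _]; last first.
    by rewrite [X in _ * X]mxE -expr2 sqr_ge0.
  rewrite mem_index_enum => /(_ isT); rewrite [X in _ * X]mxE -expr2 sqrf_eq0.
  by move=> /eqP; rewrite mxE.
by apply: (row_free_inj rF); rewrite vF0 mul0mx.
Qed.

Lemma penrose_exists m r n (C : 'M[R]_(m, r)) (F : 'M[R]_(r, n)) :
  row_full C -> row_free F -> exists X, penrose (C *m F) X.
Proof.
move=> fC /row_free_gram uF.
have uC : C^T *m C \in unitmx.
  have h : row_free C^T by rewrite /row_free mxrank_tr.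
  by have := row_free_gram h; rewrite trmxK.
pose G := invmx (F *m F^T); pose K := invmx (C^T *m C).
have GT : G^T = G by rewrite /G trmx_inv trmx_mul trmxK.
have KT : K^T = K by rewrite /K trmx_inv trmx_mul trmxK.
pose X := F^T *m G *m K *m C^T.
have AX : C *m F *m X = C *m K *m C^T.
  rewrite /X -!mulmxA; congr (_ *m _).
  by rewrite (mulmxA F) (mulmxA (F *m _)) mulmxV // mul1mx.
have XA : X *m (C *m F) = F^T *m G *m F.
  rewrite /X -!mulmxA; congr (_ *m (_ *m _)).
  by rewrite [C^T *m _]mulmxA mulmxA mulVmx // mul1mx.
exists X; split.
- rewrite AX -!mulmxA [C^T *m _]mulmxA (mulmxA K) mulVmx // mul1mx //.
- rewrite XA /X -!mulmxA; congr (_ *m (_ *m _)).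
  by rewrite (mulmxA F) (mulmxA (F *m _)) mulmxV // mul1mx.
- by rewrite AX !trmx_mul trmxK KT mulmxA.
- by rewrite XA !trmx_mul trmxK GT mulmxA.
Qed.

Lemma penrose_mpinv m n (A : 'M[R]_(m, n)) : penrose A (mpinv A).
Proof.
have [X pX] := penrose_exists (col_base_full A) (row_base_free A).
by rewrite mulmx_base in pX; exact: (xgetPex 0 (ex_intro _ X pX)).
Qed.

End MoorePenrose.

Section LebesgueTuple.
Context {R : realType}.
Local Notation RT := (measurableTypeR R).
Local Open Scope ereal_scope.

Definition tuple_of_pair n (p : RT * n.-tuple RT) : n.+1.-tuple RT :=
  [tuple of p.1 :: p.2].
Definition pair_of_tuple n (t : n.+1.-tuple RT) : RT * n.-tuple RT :=
  (thead t, [tuple of behead t]).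

Lemma tuple_of_pairK n : cancel (@tuple_of_pair n) (@pair_of_tuple n).
Proof.
case=> x t; rewrite /pair_of_tuple theadE.
by apply: (congr1 (pair x)); exact/val_inj.
Qed.

Lemma measurable_tuple_of_pair n : measurable_fun setT (@tuple_of_pair n).
Proof. exact: (measurable_cons measurable_fst measurable_snd). Qed.

Lemma measurable_pair_of_tuple n : measurable_fun setT (@pair_of_tuple n).
Proof.
apply/measurable_fun_pairP; split; last exact: measurable_behead.
exact: (measurable_tnth ord0).
Qed.

Section step.
Variables (n : nat) (mu : {sigma_finite_measure set (n.-tuple RT) -> \bar R}).

Definition lebesgue_tupleS : set (n.+1.-tuple RT) -> \bar R :=
  pushforward (@lebesgue_measure R \x mu) (@tuple_of_pair n).

Let measurable_preimage A :
  measurable A -> measurable (@tuple_of_pair n @^-1` A).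
Proof.
by move=> mA; rewrite -[X in measurable X]setTI; exact: measurable_tuple_of_pair.
Qed.

Let lebesgue_tupleS0 : lebesgue_tupleS set0 = 0.
Proof. by rewrite /lebesgue_tupleS /pushforward preimage_set0 measure0. Qed.

Let lebesgue_tupleS_ge0 A : 0 <= lebesgue_tupleS A.
Proof. by rewrite /lebesgue_tupleS /pushforward measure_ge0. Qed.

Let lebesgue_tupleS_sigma_additive : semi_sigma_additive lebesgue_tupleS.
Proof.
move=> F mF tF mUF; rewrite /lebesgue_tupleS /pushforward preimage_bigcup.
apply: measure_semi_sigma_additive.
- by move=> i; exact: measurable_preimage.
- apply/trivIsetP => /= i j _ _ ij; rewrite -preimage_setI.
  by move/trivIsetP : tF => /(_ _ _ _ _ ij) ->//; rewrite preimage_set0.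
- by rewrite -preimage_bigcup; exact: measurable_preimage.
Qed.

HB.instance Definition _ := isMeasure.Build _ _ _ lebesgue_tupleS
  lebesgue_tupleS0 lebesgue_tupleS_ge0 lebesgue_tupleS_sigma_additive.

Let lebesgue_tupleS_sigma_finite : sigma_finite setT lebesgue_tupleS.
Proof.
have /sigma_finiteP[F [TF ndF Foo]] := sigma_finiteT (@lebesgue_measure R).
have /sigma_finiteP[G [TG ndG Goo]] := sigma_finiteT mu.
exists (fun k => @pair_of_tuple n @^-1` (F k `*` G k)).
  apply/esym/seteqP; split=> // t _.
  have [k _ Fk] : (\bigcup_k F k) (thead t) by rewrite -TF.
  have [l _ Gl] : (\bigcup_k G k) [tuple of behead t] by rewrite -TG.
  exists (maxn k l) => //; split => /=.
    by move: Fk; exact/subsetPset/ndF/leq_maxl.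
  by move: Gl; exact/subsetPset/ndG/leq_maxr.
move=> k; have [mF Fk] := Foo k; have [mG Gk] := Goo k; split.
  rewrite -[X in measurable X]setTI; apply: measurable_pair_of_tuple => //.
  exact: measurableX.
rewrite /lebesgue_tupleS /pushforward -comp_preimage.
rewrite (_ : _ \o _ = id); last first.
  by apply/funext => p /=; exact: tuple_of_pairK.
by rewrite preimage_id product_measure1E// lte_mul_pinfty// ge0_fin_numE.
Qed.

HB.instance Definition _ := Measure_isSigmaFinite.Build _ _ _
  lebesgue_tupleS lebesgue_tupleS_sigma_finite.

End step.

(* n-dimensional Lebesgue measure on R^n = R x R^(n-1) as an iterated product.
   The sigma-algebra on n-tuples is the Borel one; null sets in the completed
   sense are recovered by the library's notion of negligible set. *)
Fixpoint lebesgue_tuple (n : nat) :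
    {sigma_finite_measure set (n.-tuple RT) -> \bar R} :=
  if n is n'.+1 then lebesgue_tupleS (lebesgue_tuple n')
  else \d_([tuple] : 0.-tuple RT).

Lemma lebesgue_tuple_box n (A : 'I_n -> set RT) :
  (forall i, measurable (A i)) ->
  lebesgue_tuple n [set t | forall i, A i (tnth t i)] =
  \prod_(i < n) @lebesgue_measure R (A i).
Proof.
elim: n A => [|n IH] A mA.
  rewrite big_ord0 /= diracE (_ : _ \in _) // inE /=.
  by case.
have mB : measurable [set t : n.-tuple RT | forall i, A (lift ord0 i) (tnth t i)].
  rewrite (_ : [set _ | _] =
      \bigcap_(i in [set: 'I_n]) ((fun t => tnth t i) @^-1` A (lift ord0 i))).
    apply: fin_bigcap_measurable => // i _.
    by rewrite -[X in measurable X]setTI; exact: measurable_tnth.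
  by apply/seteqP; split => [t At i _|t At i]; exact: At.
rewrite /= /lebesgue_tupleS /pushforward big_ord_recl.
rewrite -IH //.
rewrite -(product_measure1E (@lebesgue_measure R) _ (mA ord0) mB).
congr (product_measure1 _ _ _).
apply/seteqP; split=> [[x t] /= h|[x t] /= [h0 h] i].
  by split=> [|i]; [exact: (h ord0)|have := h (lift ord0 i); rewrite tnthS].
by have [j ->|->] := unliftP ord0 i; rewrite ?tnthS ?tnth0.
Qed.

End LebesgueTuple.

(* The number (Nx + Nu) * T of rows of a closed-loop map, written as block sums
   so that it is the height of the block matrices below. *)
Notation sldim Nx Nu T := (\sum_(t < T) Nx + \sum_(t < T) Nu)%N.

Section SystemLevel.
Context {R : realType}.
Variables (Nx Nu T : nat) (A : 'M[R]_Nx) (B : 'M[R]_(Nx, Nu)).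

(* [x; u] stacks x(0), ..., x(T-1), u(0), ..., u(T-1); the values of x and u at
   later times are ignored. *)
Definition stack k (x : nat -> 'M[R]_(Nx, k)) (u : nat -> 'M[R]_(Nu, k)) :
    'M[R]_(sldim Nx Nu T, k) :=
  col_mx (\mxcol_(t < T) x t) (\mxcol_(t < T) u t).

Definition closed_loop (phi : 'M[R]_(sldim Nx Nu T, Nx)) : Prop :=
  exists (phix : nat -> 'M[R]_Nx) (phiu : nat -> 'M[R]_(Nu, Nx)),
    [/\ phi = stack phix phiu,
        phix 0%N = 1%:M,
        forall t, (t.+1 < T)%N -> phix t.+1 = A *m phix t + B *m phiu t
      & A *m phix T.-1 + B *m phiu T.-1 = 0].

Definition ZAB0 :
    'M[R]_(\sum_(t < T.+1) Nx, sldim Nx Nu T) :=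
  row_mx
    (\mxblock_(t < T.+1, s < T)
       (if t == s :> nat then 1%:M else if t == s.+1 :> nat then - A else 0))
    (\mxblock_(t < T.+1, s < T) (if t == s.+1 :> nat then - B else 0)).

Lemma ZAB0_stack k (x : nat -> 'M[R]_(Nx, k)) (u : nat -> 'M[R]_(Nu, k)) :
  (0 < T)%N ->
  ZAB0 *m stack x u =
  \mxcol_(t < T.+1) (if t == 0%N :> nat then x 0%N
                     else if (t < T)%N then x t - (A *m x t.-1 + B *m u t.-1)
                     else - (A *m x t.-1 + B *m u t.-1)).
Proof.
move=> T0; rewrite /ZAB0 /stack mul_row_col !mxblockEv !mxcol_mul -mxcolD.
apply/eq_mxcolP => t; rewrite !mul_mxrow_mxcol.
have pick (j : nat) (f : nat -> 'M[R]_(Nx, k)) :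
    \sum_(s < T) (if j == s :> nat then f s else 0) = if (j < T)%N then f j else 0.
  case: ltnP => jT.
    rewrite (bigD1 (Ordinal jT)) //= eqxx big1 ?addr0 // => s.
    by rewrite -val_eqE /= eq_sym => /negbTE ->.
  by rewrite big1 // => s _; rewrite gtn_eqF // (leq_trans (ltn_ord s)).
rewrite (eq_bigr (fun s : 'I_T => (if t == s :> nat then x s else 0) +
    (if t == s.+1 :> nat then - (A *m x s) else 0))); last first.
  move=> s _; have [->|_] := eqVneq (t : nat) s.
    by rewrite mul1mx ltn_eqF // addr0.
  by case: eqP => _; rewrite ?mulNmx ?mul0mx add0r.
rewrite big_split /= pick -addrA -big_split /=.
rewrite (eq_bigr (fun s : 'I_T => if t == s.+1 :> nat then
    - (A *m x s + B *m u s) else 0)); last first.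
  by move=> s _; case: eqP => _; rewrite ?mulNmx ?mul0mx ?addr0 // opprD.
case: (t : nat) (ltn_ord t) => [|j] jT /=.
  by rewrite T0 big1 ?addr0.
under eq_bigr do rewrite eqSS.
rewrite (pick _ (fun s => - (A *m x s + B *m u s))) -[(j < T)%N]/(j.+1 < T.+1)%N jT.
by case: ifP => _; rewrite ?add0r.
Qed.

Lemma closed_loopE (phi : 'M[R]_(sldim Nx Nu T, Nx)) : (0 < T)%N ->
  closed_loop phi <->
  ZAB0 *m phi = \mxcol_(t < T.+1) (if t == 0%N :> nat then 1%:M else 0 : 'M[R]_Nx).
Proof.
move=> T0; split=> [[x [u [-> x0 xS xT]]]|].
  rewrite ZAB0_stack //; apply/eq_mxcolP => -[[|t] tT] //=.
  case: ltnP => [tT'|Tt]; first by rewrite xS ?subrr.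
  suff -> : t = T.-1 by rewrite xT oppr0.
  by apply/eqP; rewrite -eqSS prednK // eqn_leq Tt -ltnS tT.
pose x t := if insub t is Some s then submxcol (usubmx phi) s else 0 : 'M[R]_Nx.
pose u t := if insub t is Some s then submxcol (dsubmx phi) s else 0 : 'M[R]_(Nu, Nx).
have phiE : phi = stack x u.
  rewrite -[LHS]vsubmxK /stack; congr col_mx.
    by rewrite -[LHS]submxcolK; apply/eq_mxcolP => i; rewrite /x valK.
  by rewrite -[LHS]submxcolK; apply/eq_mxcolP => i; rewrite /u valK.
rewrite {1}phiE ZAB0_stack // => /eq_mxcolP h; exists x, u; split=> //.
- exact: (h ord0).
- move=> t tT; have tT' : (t.+1 < T.+1)%N by exact: ltnW.
  by have := h (Ordinal tT'); rewrite /= tT => /eqP; rewrite subr_eq0 => /eqP.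
- have := h ord_max; rewrite /= ltnn gtn_eqF // => /eqP.
  by rewrite oppr_eq0 => /eqP.
Qed.

(* S(x0): x ranges over times 0..T, but the final state x(T) is not part of s. *)
Definition trajectories (x0 : 'cV[R]_Nx) : set 'cV[R]_(sldim Nx Nu T) :=
  [set s | exists (x : nat -> 'cV[R]_Nx) (u : nat -> 'cV[R]_Nu),
    [/\ x 0%N = x0,
        forall t, (t < T)%N -> x t.+1 = A *m x t + B *m u t,
        x T = 0
      & s = stack x u]].

(* A support constraint is a set of positions (j, i) at which phi must vanish. *)
Variable supp : {set 'I_(sldim Nx Nu T) * 'I_Nx}.

Definition supported (phi : 'M[R]_(sldim Nx Nu T, Nx)) : Prop :=
  forall p, p \in supp -> phi p.1 p.2 = 0.

(* T(x0), the trajectories phi x0 of feasible closed-loop maps. *)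
Definition sls_trajectories (x0 : 'cV[R]_Nx) : set 'cV[R]_(sldim Nx Nu T) :=
  [set s | exists2 phi, closed_loop phi /\ supported phi & s = phi *m x0].

Definition Zh : 'M[R]_(sldim Nx Nu T) := 1%:M - mpinv ZAB0 *m ZAB0.

Definition supp_rows (i : 'I_Nx) : {set 'I_(sldim Nx Nu T)} :=
  [set j | (j, i) \in supp].

(* Z_h[R_i]; it has no rows when R_i is empty, and then H_i = I. *)
Definition Zh_rows (i : 'I_Nx) : 'M[R]_(#|supp_rows i|, sldim Nx Nu T) :=
  rowsub (fun k : 'I_#|supp_rows i| => enum_val k) Zh.

Definition Hblock (i : 'I_Nx) : 'M[R]_(sldim Nx Nu T) :=
  1%:M - mpinv (Zh_rows i) *m Zh_rows i.

Definition Hmx : 'M[R]_(sldim Nx Nu T, \sum_(i < Nx) sldim Nx Nu T) :=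
  \mxrow_(i < Nx) Hblock i.

End SystemLevel.

Arguments closed_loop {R Nx Nu} T A B phi.
Arguments trajectories {R Nx Nu} T A B x0.
Arguments sls_trajectories {R Nx Nu} T A B supp x0.
Arguments Hblock {R Nx Nu} T A B supp i.
Arguments Hmx {R Nx Nu} T A B supp.

(* Main.v *)
Require Import Defs.
From HB Require Import structures.
From mathcomp Require Import all_boot all_order all_algebra.
From mathcomp Require Import all_classical all_reals all_analysis.
Set Implicit Arguments.
Unset Strict Implicit.
Unset Printing Implicit Defensive.

Import Order.TTheory GRing.Theory Num.Theory.
Local Open Scope classical_set_scope.
Local Open Scope ring_scope.

(** The affine set of trajectories from [x0] has direction space the kernel of
    [ZAB0], on which [Zh] is the orthogonal projection.  A feasible map [phi]
    gives one trajectory [phi *m x0], and every other trajectory [s] differs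
    from it by an element [d] of the range of [Zh].  The feasible perturbations
    of [phi] act column by column: column [i] may move by any
    [Zh *m Hblock i *m v], because the rows of [Zh] in the support constraint
    annihilate [Hblock i].  Perturbing column [i] changes [phi *m x0] by that
    vector times the [i]-th entry of [x0]; so if no entry of [x0] vanishes, the
    perturbed maps reach exactly [phi *m x0] plus the sum over [i] of the ranges
    of [Zh *m Hblock i], i.e. plus the range of [Zh *m Hmx].  The rank condition
    says that this range is the whole range of [Zh]
    ([mulmx_full_rank_factor]), hence contains [d]
    ([trajectories_eq_sls]).  The excluded initial states form finitely many
    coordinate hyperplanes, which are null ([ae_tnth_neq0]). *)

(** Multiplying on the right can only shrink the column space, so equal ranks
    force equal column spaces. *)
Lemma mulmx_full_rank_factor (F : fieldType) m n p
    (M : 'M[F]_(m, n)) (N : 'M[F]_(n, p)) :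
  \rank M = \rank (M *m N) -> exists K, M = M *m N *m K.
Proof.
move=> rMN; have sub : ((M *m N)^T <= M^T)%MS by rewrite trmx_mul submxMl.
have /submxP[K MK] : (M^T <= (M *m N)^T)%MS.
  by rewrite -(mxrank_leqif_sup sub) !mxrank_tr rMN.
by exists K^T; apply: trmx_inj; rewrite trmx_mul trmxK.
Qed.

Lemma mulmx_subr_mpinv (R : realType) m n (M : 'M[R]_(m, n)) :
  M *m (1%:M - mpinv M *m M) = 0.
Proof.
by have [MXM _ _ _] := penrose_mpinv M; rewrite mulmxBr mulmx1 mulmxA MXM subrr.
Qed.

Section Trajectories.
Context {R : realType} {Nx Nu T : nat}.
Variables (A : 'M[R]_Nx) (B : 'M[R]_(Nx, Nu)).
Hypothesis T_gt0 : (0 < T)%N.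

Lemma mul_stack k l (x : nat -> 'M[R]_(Nx, k)) (u : nat -> 'M[R]_(Nu, k))
    (y : 'M[R]_(k, l)) :
  stack T x u *m y = stack T (fun t => x t *m y) (fun t => u t *m y).
Proof. by rewrite /stack mul_col_mx !mxcol_mul. Qed.

Lemma Zh_ker (d : 'cV[R]_(sldim Nx Nu T)) :
  ZAB0 T A B *m d = 0 -> Zh T A B *m d = d.
Proof. by move=> Zd; rewrite /Zh mulmxBl mul1mx -mulmxA Zd mulmx0 subr0. Qed.

Lemma ZAB0_trajectory (x0 : 'cV[R]_Nx) s : trajectories T A B x0 s ->
  ZAB0 T A B *m s =
  \mxcol_(t < T.+1) (if t == 0%N :> nat then 1%:M else 0 : 'M[R]_Nx) *m x0.
Proof.
case=> x [u [x0E xS xT ->]]; rewrite ZAB0_stack // mxcol_mul.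
apply/eq_mxcolP => -[[|t] tT] /=; first by rewrite mul1mx.
rewrite mul0mx -xS //; case: ltnP => [_|Tt]; first by rewrite subrr.
have -> : t.+1 = T by apply/eqP; rewrite eqn_leq Tt andbT.
by rewrite xT oppr0.
Qed.

Lemma sls_trajectories_sub supp (x0 : 'cV[R]_Nx) :
  sls_trajectories T A B supp x0 `<=` trajectories T A B x0.
Proof.
move=> _ [_ [[phix [phiu [-> phi0 phiS phiT]]] _] ->].
(* The stack ignores the state at time T, which has to be 0. *)
exists (fun t => if (t < T)%N then phix t *m x0 else 0).
exists (fun t => phiu t *m x0).
rewrite T_gt0 ltnn mul_stack; split=> //; first by rewrite phi0 mul1mx.
- move=> t tT; rewrite tT !mulmxA -mulmxDl; case: ltnP => [tT'|Tt].
    by rewrite phiS.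
  have -> : t = T.-1 by apply/eqP; rewrite -eqSS prednK // eqn_leq Tt tT.
  by rewrite phiT mul0mx.
- by congr col_mx; apply/eq_mxcolP => t; rewrite ltn_ord.
Qed.

Section Perturbation.
Variable supp : {set 'I_(sldim Nx Nu T) * 'I_Nx}.

(** The rows of [Zh] listed in [supp_rows i] make up [Zh_rows i], and [Hblock i]
    projects onto its kernel. *)
Lemma Zh_Hblock_supp k (v : 'M[R]_(_, k)) i j l :
  (j, i) \in supp -> (Zh T A B *m Hblock T A B supp i *m v) j l = 0.
Proof.
move=> ji; have jR : j \in supp_rows supp i by rewrite inE.
have : Zh_rows A B supp i *m Hblock T A B supp i *m v = 0.
  by rewrite mulmx_subr_mpinv mul0mx.
move=> /matrixP/(_ (enum_rank_in jR j) l).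
by rewrite !mul_rowsub_mx [LHS]mxE [RHS]mxE enum_rankK_in.
Qed.

Definition perturbation (v : 'I_Nx -> 'cV[R]_(sldim Nx Nu T)) :
    'M[R]_(sldim Nx Nu T, Nx) :=
  \matrix_(j, i) (Zh T A B *m Hblock T A B supp i *m v i) j 0.

Lemma col_perturbation v i :
  col i (perturbation v) = Zh T A B *m Hblock T A B supp i *m v i.
Proof. by apply/colP => j; rewrite !mxE. Qed.

Lemma feasible_perturbation phi v :
  closed_loop T A B phi /\ supported supp phi ->
  closed_loop T A B (phi + perturbation v) /\
  supported supp (phi + perturbation v).
Proof.
move=> [clphi suppphi]; split.
  apply/closed_loopE => //; move/closed_loopE : clphi => /(_ T_gt0) <-.
  rewrite mulmxDr [X in _ + X](_ : _ = 0) ?addr0 //.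
  apply/matrixP => r i; have /colP/(_ r) : col i (ZAB0 T A B *m perturbation v) = 0.
    by rewrite colE -mulmxA -colE col_perturbation !mulmxA mulmx_subr_mpinv !mul0mx.
  by rewrite !mxE.
by move=> [j i] ji; rewrite mxE suppphi // add0r mxE Zh_Hblock_supp.
Qed.

Lemma trajectories_eq_sls (x0 : 'cV[R]_Nx) :
  (exists phi, closed_loop T A B phi /\ supported supp phi) ->
  \rank (Zh T A B) = \rank (Zh T A B *m Hmx T A B supp) ->
  (forall i, x0 i 0 != 0) ->
  trajectories T A B x0 = sls_trajectories T A B supp x0.
Proof.
move=> [phi feas] rk x0_neq0; apply/seteqP; split; last first.
  exact: sls_trajectories_sub.
move=> s straj; have [K ZhK] := mulmx_full_rank_factor rk.
pose d := s - phi *m x0; pose lam := K *m d.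
have dE : d = \sum_i Zh T A B *m Hblock T A B supp i *m submxcol lam i.
  have Zd : ZAB0 T A B *m d = 0.
    rewrite mulmxBr mulmxA (ZAB0_trajectory straj).
    by move/closed_loopE : feas.1 => /(_ T_gt0) ->; rewrite subrr.
  rewrite -[LHS](Zh_ker Zd) [in LHS]ZhK -[LHS]mulmxA -[LHS]mulmxA -/lam.
  rewrite -[in LHS](submxcolK lam).
  rewrite mul_mxrow_mxcol mulmx_sumr.
  by apply: eq_bigr => i _; rewrite mulmxA.
(* Column i enters the product with x0 scaled by the i-th entry of x0. *)
exists (phi + perturbation (fun i => (x0 i 0)^-1 *: submxcol lam i)).
  exact: feasible_perturbation.
rewrite mulmxDl -[LHS](subrKC (phi *m x0)) -/d; congr (_ + _).
rewrite [LHS]dE; apply/colP => j; rewrite summxE [RHS]mxE; apply: eq_bigr => i _.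
by rewrite [in RHS]mxE -scalemxAr [in RHS]mxE mulrAC mulVf // mul1r.
Qed.

End Perturbation.
End Trajectories.

(** A coordinate hyperplane is a box with one side [[set 0]], of length 0. *)
Lemma ae_tnth_neq0 (R : realType) n :
  {ae lebesgue_tuple n, forall x : n.-tuple (measurableTypeR R),
     forall i, tnth x i != 0 :> R}.
Proof.
pose P i := [set x : n.-tuple (measurableTypeR R) | tnth x i = 0].
have Pnull i : (@lebesgue_tuple R n).-negligible (P i).
  exists (P i); split=> //.
    rewrite -[P i]setTI.
    exact: (measurable_tnth i measurableT (measurable_set1 (0 : R))).
  pose side j : set (measurableTypeR R) := if j == i then [set 0] else setT.
  have mside j : measurable (side j) by rewrite /side; case: ifP.
  have -> : P i = [set x | forall j, side j (tnth x j)].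
    apply/seteqP; split=> x /=; rewrite /P /side.
      by move=> xi j; case: eqP => // ->.
    by move=> /(_ i); rewrite eqxx.
  rewrite lebesgue_tuple_box // (bigD1 i) //= /side eqxx.
  by rewrite lebesgue_measure_set1 mul0e.
have : (@lebesgue_tuple R n).-negligible (\big[setU/set0]_(i < n) P i).
  by elim/big_ind : _ => //; [exact: negligible_set0|exact: negligibleU].
apply: negligibleS => x /= /existsNP[i /negP/negPn/eqP xi].
by rewrite -bigcup_seq; exists i => //=; rewrite mem_index_enum.
Qed.

Theorem theorem9 (R : realType) (Nx Nu T : nat)
    (hNx : (0 < Nx)%N) (hNu : (0 < Nu)%N) (hT : (0 < T)%N)
    (A : 'M[R]_Nx) (B : 'M[R]_(Nx, Nu))
    (supp : {set 'I_(sldim Nx Nu T) * 'I_Nx})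
    (hfeas : exists phi : 'M[R]_(sldim Nx Nu T, Nx),
       closed_loop T A B phi /\ supported supp phi)
    (hrank : \rank (Zh T A B) = \rank (Zh T A B *m Hmx T A B supp)) :
  {ae lebesgue_tuple Nx, forall x : Nx.-tuple (measurableTypeR R),
     let x0 := \col_i (tnth x i : R) in
     trajectories T A B x0 = sls_trajectories T A B supp x0}.
Proof.
apply: filterS (@ae_tnth_neq0 R Nx) => x x_neq0 /=.
by apply: trajectories_eq_sls => // i; rewrite mxE.
Qed.
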